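(* Let $K\ge 1$, $t_1\in(0,1)$, $\boldsymbol{\delta}=(\delta_1,\dots,\delta_K)'\in\mathbb{R}^K$, and let $f$ be a probability density on $\mathbb{R}^K$ that is symmetric ($f(-\mathbf{x})=f(\mathbf{x})$), positive and continuously differentiable, with finite second moments, finite Fisher information matrix $\mathbb{E}_f[\nabla\log f(\mathbf{X})\nabla\log f(\mathbf{X})']$, and bounded marginal densities $f_1,\dots,f_K$. Assume that $f$ may be written as the product of its marginals, $f(\mathbf{x})=\prod_{k=1}^K f_k(x_k)$. Let $$d_H(\boldsymbol\delta)=t_1(1-t_1)\,\boldsymbol\delta'C^{-1}\boldsymbol\delta,\qquad d_S(\boldsymbol\delta)=4t_1(1-t_1)\,\boldsymbol\delta'A'\Sigma^{-1}A\boldsymbol\delta .$$ Then $$d_H(\boldsymbol\delta)=t_1(1-t_1)\sum_{k=1}^K\frac{\delta_k^2}{\sigma_k^2}\qquad\text{and}\qquad d_S(\boldsymbol\delta)=12\,t_1(1-t_1)\sum_{k=1}^K\frac{\delta_k^2}{\sigma_k^2}\lambda_k^2,$$ where $\sigma_k^2=\int x^2f_k(x)\,dx$ and $\lambda_k=\int(\sigma_kf_k(\sigma_kx))^2\,dx$. Moreover, $d_S(\boldsymbol\delta)\ge\frac{108}{125}\,d_H(\boldsymbol\delta)$, with $d_S(\boldsymbol\delta)=\frac{3}{\pi}\,d_H(\boldsymbol\delta)$ when the $f_k$ are Gaussian densities.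
   Context: The prime denotes transposition. $\mathbf{X}=(X_1,\dots,X_K)'$ denotes a random vector with density $f$, $C$ its covariance matrix, and $F_k$ the c.d.f. of $X_k$. $F(\mathbf{X})=(F_1(X_1),\dots,F_K(X_K))'$, and $F(\mathbf{X})-1/2$ means subtracting $1/2$ from every coordinate. The $K\times K$ matrices $\Sigma$ and $A$ are $$\Sigma_{kk'}=4\operatorname{Cov}(F_k(X_k),F_{k'}(X_{k'})),\qquad A=\mathbb{E}_f[(F(\mathbf{X})-1/2)\,\nabla\log f(\mathbf{X})'].$$ $d_H$ and $d_S$ are the asymptotic non-centrality parameters, under local shift alternatives, of Hotelling's $T^2$ test and of the rank test, respectively. *)

(* Defs.v *)
From HB Require Import structures.
From mathcomp Require Import all_boot all_order all_algebra.
From mathcomp Require Import all_classical all_reals all_analysis.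

Set Implicit Arguments.
Unset Strict Implicit.
Unset Printing Implicit Defensive.

Import Order.TTheory GRing.Theory Num.Theory.
Import numFieldNormedType.Exports.

Local Open Scope classical_set_scope.
Local Open Scope ring_scope.

Section tuple_cons.
Context d (T : measurableType d).

Definition tuple_cons n (p : T * n.-tuple T) : n.+1.-tuple T :=
  [tuple of p.1 :: p.2].

Lemma measurable_tuple_cons n :
  measurable_fun [set: T * n.-tuple T] (@tuple_cons n).
Proof.
by apply: measurable_cons; [exact: measurable_fst|exact: measurable_snd].
Qed.

End tuple_cons.

Section lebesgue_tupleS.
Context (R : realType) n
  (m : {sigma_finite_measure set (n.-tuple (measurableTypeR R)) -> \bar R}).

Definition lebesgue_tupleS : set (n.+1.-tuple (measurableTypeR R)) -> \bar R :=
  pushforward (@lebesgue_measure R \x m)%E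
    (@tuple_cons _ (measurableTypeR R) n).

Let lebesgue_tupleS0 : lebesgue_tupleS set0 = 0%E.
Proof. by rewrite /lebesgue_tupleS /pushforward preimage_set0 measure0. Qed.

Let lebesgue_tupleS_ge0 A : (0 <= lebesgue_tupleS A)%E.
Proof. by rewrite /lebesgue_tupleS /pushforward measure_ge0. Qed.

Let lebesgue_tupleS_sigma_additive : semi_sigma_additive lebesgue_tupleS.
Proof.
have mc := @measurable_tuple_cons _ (measurableTypeR R) n.
exact: measure_semi_sigma_additive.
Qed.

HB.instance Definition _ := isMeasure.Build _ _ _ lebesgue_tupleS
  lebesgue_tupleS0 lebesgue_tupleS_ge0 lebesgue_tupleS_sigma_additive.

Let lebesgue_tupleS_sigma_finite : sigma_finite setT lebesgue_tupleS.
Proof.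
have /sigma_finiteP[F [TF ndF Foo]] := sigma_finiteT (@lebesgue_measure R).
have /sigma_finiteP[G [TG ndG Goo]] := sigma_finiteT m.
pose g (t : n.+1.-tuple (measurableTypeR R)) := (thead t, [tuple of behead t]).
have cK : cancel (@tuple_cons _ (measurableTypeR R) n) g.
  move=> [x t]; rewrite /g /tuple_cons /=; congr (_, _).
  by apply/val_inj.
have mg : measurable_fun setT g.
  apply: measurable_fun_pair; last exact: measurable_behead.
  exact: (@measurable_tnth _ (measurableTypeR R) n.+1 ord0).
exists (fun k => g @^-1` (F k `*` G k)).
  rewrite -preimage_bigcup (_ : \bigcup_k _ = setT) ?preimage_setT//.
  rewrite -subTset => -[x y] _.
  have [i _ Fix] : (\bigcup_i F i) x by rewrite -TF.
  have [j _ Gjy] : (\bigcup_i G i) y by rewrite -TG.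
  exists (maxn i j) => //; split => /=.
    by move: x Fix; exact/subsetPset/ndF/leq_maxl.
  by move: y Gjy; exact/subsetPset/ndG/leq_maxr.
move=> k; have [mF Fk] := Foo k; have [mG Gk] := Goo k; split.
  by rewrite -[X in measurable X]setTI; apply: mg => //; exact: measurableX.
rewrite /lebesgue_tupleS /pushforward -comp_preimage.
rewrite (_ : g \o _ = id); last by apply/funext => x /=; rewrite cK.
rewrite preimage_id product_measure1E// lte_mul_pinfty// ge0_fin_numE//.
Qed.

HB.instance Definition _ := Measure_isSigmaFinite.Build _ _ _ lebesgue_tupleS
  lebesgue_tupleS_sigma_finite.

End lebesgue_tupleS.

(* Lebesgue measure on R^n. Tuples are used because n.-tuple T carries the
   product sigma-algebra, whereas matrices only carry the topological and
   normed structures needed for differentiation; [col_of_tuple] below links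
   the two. *)
Fixpoint lebesgue_tuple (R : realType) n :
    {sigma_finite_measure set (n.-tuple (measurableTypeR R)) -> \bar R} :=
  if n is n'.+1 then lebesgue_tupleS (lebesgue_tuple R n')
  else \d_([tuple] : 0.-tuple (measurableTypeR R)).

Lemma lebesgue_tuple_box (R : realType) n
    (B : 'I_n -> set (measurableTypeR R)) :
  (forall i, measurable (B i)) ->
  lebesgue_tuple R n [set t | forall i, B i (tnth t i)] =
    (\prod_(i < n) lebesgue_measure (B i))%E.
Proof.
elim: n B => [|n IHn] B mB.
  rewrite big_ord0 /= diracE mem_set //= => i; by case: i.
rewrite big_ord_recl /= /lebesgue_tupleS /pushforward.
set C := [set t : n.-tuple (measurableTypeR R) |
  forall i, B (lift ord0 i) (tnth t i)].
rewrite -(IHn (fun i => B (lift ord0 i))) // -/C.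
have mC : measurable C.
  rewrite (_ : C = \bigcap_(i in [set: 'I_n])
      ((@tnth n (measurableTypeR R))^~ i @^-1` B (lift ord0 i))).
    apply: fin_bigcap_measurable; [exact: finite_finset|move=> i _].
    by rewrite -[X in measurable X]setTI; exact: measurable_tnth.
  by apply/seteqP; split=> [t Ct i _|t Ct i]; exact: Ct.
rewrite -product_measure1E//; congr (_ _); apply/seteqP.
split=> -[x t] /=; rewrite /C /tuple_cons /=.
  move=> Bt; split=> [|i]; first exact: (Bt ord0).
  by have := Bt (lift ord0 i); rewrite tnthS.
by move=> [Bx Bt] i; case: (unliftP ord0 i) => [j ->|->//]; rewrite tnthS.
Qed.

Section density.
Context (R : realType) (K : nat).
Implicit Type f : 'cV[R]_K -> R.

Definition col_of_tuple (t : K.-tuple (measurableTypeR R)) : 'cV[R]_K :=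
  \col_k tnth t k.

Definition is_pdf f :=
  [/\ measurable_fun [set: K.-tuple (measurableTypeR R)] (f \o col_of_tuple),
      forall x, 0 <= f x &
      (\int[lebesgue_tuple R K]_t (f (col_of_tuple t))%:E = 1)%E].

Definition gradient f (x : 'cV[R]_K) : 'cV[R]_K :=
  \col_k 'D_(delta_mx k 0) f x.

Definition continuously_differentiable f :=
  (forall x, differentiable f x) /\ continuous (gradient f).

(* the point of R^K with k-th coordinate y and remaining coordinates t *)
Definition insert_coord (k : 'I_K) (y : R) (t : K.-1.-tuple (measurableTypeR R))
    : 'cV[R]_K :=
  \col_j if unlift k j is Some i then tnth t i else y.

(* Extended-real valued, so that a uniform bound on it also says that it is
   finite; [fine] would send +oo to 0. *)
Definition marginal f (k : 'I_K) (y : R) : \bar R :=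
  (\int[lebesgue_tuple R K.-1]_t (f (insert_coord k y t))%:E)%E.

Definition marginal_density f (k : 'I_K) (y : R) : R := fine (marginal f k y).

End density.

Section random_vector.
Context d (T : measurableType d) (R : realType) (P : probability T R) (K : nat).

Definition random_col (X : 'I_K -> T -> R) (w : T) : 'cV[R]_K := \col_k X k w.

Definition has_density (X : 'I_K -> T -> R) (f : 'cV[R]_K -> R) :=
  forall B : set (K.-tuple (measurableTypeR R)), measurable B ->
    P [set w | B [tuple X k w | k < K]] =
      (\int[lebesgue_tuple R K]_(t in B) (f (col_of_tuple t))%:E)%E.

Definition covariance_mx (X : 'I_K -> T -> R) : 'M[R]_K :=
  \matrix_(k, l) fine (covariance P (X k) (X l)).

(* F_k(X_k) *)
Definition cdf_transform (X : 'I_K -> {RV P >-> R}) (k : 'I_K) (w : T) : R :=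
  fine (cdf (X k) (X k w)).

Definition score (X : 'I_K -> T -> R) (f : 'cV[R]_K -> R) (w : T) : 'cV[R]_K :=
  gradient (fun x => ln (f x)) (random_col X w).

Definition finite_second_moments (X : 'I_K -> T -> R) :=
  forall k, P.-integrable setT (fun w => (X k w ^+ 2)%:E).

Definition finite_fisher_information (X : 'I_K -> T -> R) (f : 'cV[R]_K -> R) :=
  forall k l,
    P.-integrable setT (fun w => (score X f w k 0 * score X f w l 0)%:E).

Definition Sigma_mx (X : 'I_K -> {RV P >-> R}) : 'M[R]_K :=
  4 *: covariance_mx (cdf_transform X).

Definition A_mx (X : 'I_K -> {RV P >-> R}) (f : 'cV[R]_K -> R) : 'M[R]_K :=
  \matrix_(k, l)
    fine ('E_P[(fun w => (cdf_transform X k w - 2^-1) * score X f w l 0)%R])%E.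

End random_vector.

Section noncentrality.
Context (R : realType) (K : nat) (t1 : R).

Definition d_H (C : 'M[R]_K) (delta : 'cV[R]_K) : R :=
  t1 * (1 - t1) * (delta^T *m invmx C *m delta) 0 0.

Definition d_S (Sigma A : 'M[R]_K) (delta : 'cV[R]_K) : R :=
  4 * t1 * (1 - t1) * (delta^T *m A^T *m invmx Sigma *m A *m delta) 0 0.

End noncentrality.

Section univariate.
Context (R : realType) (g : R -> R).

(* The second moment: the variance when g is symmetric. *)
Definition sigma2 : R := \int[lebesgue_measure]_x (x ^+ 2 * g x).
Definition sigma : R := Num.sqrt sigma2.
Definition lambda : R :=
  \int[lebesgue_measure]_x ((sigma * g (sigma * x)) ^+ 2).

(* [normal_pdf m 0] is by convention a uniform density, whence 0 < s. *)
Definition gaussian_density :=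
  exists m s : R, 0 < s /\ g = normal_pdf m s.

End univariate.

(* Main.v *)
Require Import Defs.
From HB Require Import structures.
From mathcomp Require Import all_boot all_order all_algebra.
From mathcomp Require Import all_classical all_reals all_analysis.
From mathcomp Require Import measurable_realfun.
From mathcomp Require Import ring lra.

Set Implicit Arguments.
Unset Strict Implicit.
Unset Printing Implicit Defensive.

Import Order.TTheory GRing.Theory Num.Theory.
Import numFieldNormedType.Exports.

Local Open Scope classical_set_scope.
Local Open Scope ring_scope.

(** Independence and symmetry make the three matrices diagonal, which reduces
    the statement to one-dimensional integrals.

    Write f_k for the marginal densities and F_k for their distribution
    functions. As f is the product of the f_k, the coordinates X_k are
    independent with densities f_k ([prob_indep], [expectation_marginal]), the
    f_k inherit symmetry and continuous differentiability from f, and the l-th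
    component of the score is f_l'(X_l) / f_l(X_l). Since f_k is even, both X_k
    and F_k(X_k) - 1/2 are odd functions of X_k and have mean 0; so every
    off-diagonal entry of C, Sigma and A vanishes. The diagonal entries are:
    - for C, the second moment sigma2 f_k;
    - for Sigma, 4/12 = 1/3, as F_k(X_k) is uniform on [0, 1]
      ([integral_centered_cdf_sqr]);
    - for A, the integral of (F_k - 1/2) f_k', which is minus the integral of
      f_k^2 by parts ([integral_centered_cdf_derive]).
    Both quadratic forms can then be read off, because the square of lambda f_k
    is sigma2 f_k times the square of the integral of f_k^2 ([lambda_sqrE]).

    The inequality compares the two sums term by term, as lambda^2 >= 9/125 for
    each f_k ([lambda_sqr_ge]), and 12 * 9/125 = 108/125. For a Gaussian
    density lambda^2 = 1 / (4 pi) ([gaussian_lambda_sqr]), and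
    12 / (4 pi) = 3 / pi.

    The boundary terms at infinity are handled by [Rintegral_derive_odd]: an
    odd integrable function whose derivative is integrable has a derivative of
    integral 0. It gives both the integration by parts above and the second
    moment of the Gaussian density. *)

(** * Integration over the real line *)

Section integrable_lemmas.
Context (R : realType).
Local Notation mu := (@lebesgue_measure R).
Local Notation integrable h := (mu.-integrable setT (EFin \o h)).
Implicit Types h g : R -> R.

Lemma integrable_itv h (i : interval R) : integrable h ->
  mu.-integrable [set` i] (EFin \o h).
Proof.
by move=> ih; apply: (integrableS measurableT) => //; exact: measurable_itv.
Qed.

Lemma integrable_le h g : measurable_fun [set: R] h ->
  (forall x, `|h x| <= g x) -> integrable g -> integrable h.
Proof.
move=> mh hg; apply: le_integrable => //; first exact/measurable_EFinP.
by move=> x _; rewrite lee_fin (le_trans (hg x))// ler_norm.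
Qed.

End integrable_lemmas.


Section integral_over_R.
Context (R : realType).
Local Notation mu := (@lebesgue_measure R).
Local Notation integrable h := (mu.-integrable setT (EFin \o h)).
Implicit Types h : R -> R.

Lemma ge0_integralT_comp_opp (h : R -> \bar R) :
  measurable_fun [set: R] h -> (forall x, 0 <= h x)%E ->
  (\int[mu]_x h (- x)%R = \int[mu]_x h x)%E.
Proof.
move=> mh h0.
have mN : measurable_fun setT (-%R : R -> measurableTypeR R).
  exact: oppr_measurable.
transitivity (\int[pushforward mu (-%R : _ -> measurableTypeR R)]_x h x)%E.
  by rewrite ge0_integral_pushforward.
by apply: eq_measure_integral => A mA _; exact: lebesgue_measureN.
Qed.

Lemma integral_odd h : integrable h -> (forall x, h (- x) = - h x) ->
  (\int[mu]_x (h x)%:E = 0)%E.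
Proof.
move=> ih oh.
rewrite integralE.
have -> : ((fun x => (h x)%:E)^\- = fun x => (EFin \o h)^\+ (- x)%R)%E.
  by apply/funext => x; rewrite funenegE funeposE /= oh EFinN.
rewrite (ge0_integralT_comp_opp (h := (EFin \o h)^\+%E))//; last first.
  by apply: measurable_funepos; exact: measurable_int ih.
by rewrite subee// integrable_pos_fin_num.
Qed.

Lemma integrable_cvg0 h (l : R) : integrable h ->
  h x @[x --> +oo%R] --> l -> l = 0.
Proof.
move=> ih hl; apply/eqP; apply/negP => /negP l0.
have l2 : 0 < `|l| / 2 by rewrite divr_gt0// normr_gt0.
have [N [_ hN]] : \forall x \near +oo, `|l| / 2 <= `|h x|.
  move/cvgrPdist_le : hl => /(_ _ l2).
  by apply: filterS => x hx; have := lerB_dist l (h x); lra.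
have mD : measurable (`]N, +oo[%classic : set R) by [].
suff : (+oo <= \int[mu]_(x in `]N, +oo[) `|(h x)%:E|)%E.
  rewrite leNgt => /negP; apply.
  apply: le_lt_trans (integrable_lty measurableT (integrable_abse ih)).
  apply: ge0_subset_integral => //.
  by apply: measurableT_comp => //; exact: measurable_int ih.
apply: (@le_trans _ _ (\int[mu]_(x in `]N, +oo[) (`|l| / 2)%:E)%E).
  rewrite integral_cst//= lebesgue_measure_itv/=.
  by rewrite ltry gt0_muley ?lte_fin.
apply: ge0_le_integral => //.
apply: measurable_funTS; apply: measurableT_comp => //.
  exact: measurable_int ih.
- by move=> x; rewrite /= in_itv/= andbT => Nx; rewrite lee_fin; exact: hN.
Qed.

(** The fundamental theorem on [-a, a] followed by dominated convergence.
    The limit is taken along all real a, and not only along the integers: this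
    is what makes [integrable_cvg0] applicable to the boundary term. *)
Lemma cvg_FTC2_symmetric h : (forall x, derivable h x 1) ->
  continuous h^`()%classic -> integrable h^`()%classic ->
  h a - h (- a) @[a --> +oo%R] --> \int[mu]_x h^`()%classic x.
Proof.
move=> dh ch ih; apply/cvg_pinftyP => u uy.
have step n : 0 < u n -> \int[mu]_(x in `[- u n, u n]) h^`()%classic x
    = h (u n) - h (- u n).
  move=> un0; rewrite /Rintegral (@continuous_FTC2 _ _ h).
  - by [].
  - lra.
  - exact: continuous_subspaceT.
  - split=> [x _||]; first exact: dh.
    + apply: cvg_at_right_filter.
      exact/differentiable_continuous/derivable1_diffP.
    + apply: cvg_at_left_filter.
      exact/differentiable_continuous/derivable1_diffP.
  - by [].
have uN : \forall n \near \oo, 0 < u n by move/cvgryPgt : uy; exact.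
pose g n x := (h^`()%classic \_ `[- u n, u n]) x.
have mh : measurable_fun [set: R] h^`()%classic.
  exact: continuous_measurable_fun.
have mg n : measurable_fun [set: R] (fun x => (g n x)%:E).
  apply/measurable_EFinP; apply/measurable_restrict => //.
  exact: measurable_funTS.
have gcvg : {ae mu, forall x, [set: R] x ->
    (g n x)%:E @[n --> \oo] --> (h^`()%classic x)%:E}.
  move/cvgryPge : uy => uy.
  apply: aeW => x _; apply: cvg_near_cst.
  near=> n; rewrite /g patchE ifT// mem_setE in_itv/= -ler_norml.
  by near: n; exact: uy.
have gdom : {ae mu, forall x n, [set: R] x ->
    (`|(g n x)%:E| <= `|(h^`()%classic x)%:E|)%E}.
  apply: aeW => x n _; rewrite /g patchE; case: ifPn => // _.
  by rewrite abse0 abse_ge0.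
have [_ _] := @dominated_convergence _ _ _ mu setT measurableT
  (fun n x => (g n x)%:E) (EFin \o h^`()%classic)
  (fun x => `|(h^`()%classic x)%:E|%E) mg
  (measurable_int mu ih) gcvg (integrable_abse ih) gdom.
rewrite -(fineK (integrable_fin_num measurableT ih)) => /fine_cvgP[_] {}gcvg.
apply: cvg_trans gcvg; apply: near_eq_cvg.
near=> n => /=; rewrite -step; last by near: n.
by rewrite Rintegral_mkcond.
Unshelve. all: by end_near. Qed.

(** For odd [h] the boundary term h(a) - h(-a) = 2 h(a) converges, and an
    integrable function can only converge to 0. So no decay of [h] at infinity
    has to be assumed in integrations by parts. *)
Lemma Rintegral_derive_odd h : (forall x, derivable h x 1) ->
  continuous h^`()%classic -> integrable h^`()%classic -> integrable h ->
  (forall x, h (- x) = - h x) -> \int[mu]_x h^`()%classic x = 0.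
Proof.
move=> dh ch ih' ih oh.
apply: (@integrable_cvg0 (fun x => 2 * h x)); first exact: (integrableZl measurableT 2 ih).
have := cvg_FTC2_symmetric dh ch ih'.
by under eq_fun do rewrite oh opprK -mulr2n -mulr_natl.
Qed.
End integral_over_R.

(** * Laws with a density, and independence *)

Section density_change_of_variables.
Context d (S : measurableType d) (R : realType)
  (mu : {sigma_finite_measure set S -> \bar R})
  (nu : {finite_measure set S -> \bar R}) (p : S -> R).
Hypotheses (p0 : forall x, 0 <= p x) (mp : measurable_fun [set: S] p)
  (nuE : forall A, measurable A -> nu A = (\int[mu]_(x in A) (p x)%:E)%E).

Lemma density_dominates : nu `<< mu.
Proof.
apply/null_content_dominatesP => A mA A0; rewrite nuE//.
by apply: null_set_integral => //; apply/measurable_EFinP; exact: measurable_funTS.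
Qed.

(** The density agrees almost everywhere with the Radon-Nikodym derivative, for
    which the change of variables is known. *)
Lemma ge0_integral_density (h : S -> \bar R) : measurable_fun [set: S] h ->
  (forall x, 0 <= h x)%E ->
  (\int[nu]_x h x = \int[mu]_x (h x * (p x)%:E))%E.
Proof.
move=> mh h0; have nm := density_dominates.
rewrite -(Radon_Nikodym_SigmaFinite.change_of_variables nm)//.
have iF := Radon_Nikodym_SigmaFinite.f_integrable nm.
apply: ae_eq_integral => //.
- by apply: emeasurable_funM => //; exact: measurable_int iF.
- by apply: emeasurable_funM => //; exact/measurable_EFinP.
apply: ae_eqe_mul2l; apply: integral_ae_eq => //; first exact/measurable_EFinP.
move=> E _ mE; rewrite -Radon_Nikodym_SigmaFinite.f_integral//; exact: nuE.
Qed.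

Lemma integrable_density (h : S -> R) : measurable_fun [set: S] h ->
  nu.-integrable setT (EFin \o h) ->
  mu.-integrable setT (EFin \o (fun x => h x * p x)).
Proof.
move=> mh /integrableP[_ ih]; apply/integrableP; split.
  by apply/measurable_EFinP; exact: measurable_funM.
rewrite ge0_integral_density//= in ih; last first.
  by do 2 apply: measurableT_comp => //.
rewrite [ltLHS](_ : _ = \int[mu]_x (`|(h x)%:E| * (p x)%:E))%E//.
by apply: eq_integral => x _; rewrite /= normrM EFinM (ger0_norm (p0 _)).
Qed.

Lemma integral_density (h : S -> R) : measurable_fun [set: S] h ->
  nu.-integrable setT (EFin \o h) ->
  (\int[nu]_x (h x)%:E = \int[mu]_x (h x * p x)%:E)%E.
Proof.
move=> mh ih.
have ihp := integrable_density mh ih.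
rewrite integralE [RHS]integralE; congr (_ - _)%E.
- rewrite ge0_integral_density//.
  + apply: eq_integral => x _.
    by rewrite !funeposE maxe_pMl ?lee_fin// mul0e -EFinM.
  + by apply: measurable_funepos; exact/measurable_EFinP.
- rewrite ge0_integral_density//.
  + apply: eq_integral => x _.
    by rewrite !funenegE maxe_pMl ?lee_fin// mul0e mulNe -EFinM.
  + by apply: measurable_funeneg; exact/measurable_EFinP.
Qed.

End density_change_of_variables.

Section independent_expectation.
Context d (T : measurableType d) (R : realType) (P : probability T R).

(** Under independence, the law of the pair is the product of the laws, and
    Fubini's theorem factors the integral. *)
Lemma expectation_indep_prod (X Y : {RV P >-> R}) (g h : R -> R) :
  (forall A B : set R, measurable A -> measurable B ->
    P (X @^-1` A `&` Y @^-1` B) = (P (X @^-1` A) * P (Y @^-1` B))%E) ->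
  measurable_fun [set: R] g -> measurable_fun [set: R] h ->
  P.-integrable setT (EFin \o (g \o X)) ->
  P.-integrable setT (EFin \o (h \o Y)) ->
  ('E_P[fun w => (g (X w) * h (Y w))%R] = 'E_P[g \o X] * 'E_P[h \o Y])%E.
Proof.
move=> XY mg mh igX ihY.
have mXY : measurable_fun [set: T] (fun w => (X w, Y w) : R * R).
  exact: measurable_fun_pair.
pose Zm := isMeasurableFun.Build _ _ _ _ _ mXY.
pose Z : {RV P >-> (R * R)%type} := HB.pack (fun w => (X w, Y w) : R * R) Zm.
pose m1 := distribution P X; pose m2 := distribution P Y.
have mE A : measurable A -> (m1 \x m2)%E A = distribution P Z A.
  by move=> mA; apply: product_measure_unique => // B C mB mC; exact: XY.
have mEg : measurable_fun [set: R] (EFin \o g) by exact/measurable_EFinP.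
have mEh : measurable_fun [set: R] (EFin \o h) by exact/measurable_EFinP.
have ig : m1.-integrable setT (EFin \o g).
  by apply: integrable_pushforward.
have ih : m2.-integrable setT (EFin \o h).
  by apply: integrable_pushforward.
pose gh (z : R * R) := (g z.1 * h z.2)%:E.
have mgh : measurable_fun setT gh.
  apply/measurable_EFinP; apply: measurable_funM.
    exact: (measurableT_comp mg measurable_fst).
  exact: (measurableT_comp mh measurable_snd).
have igh : (m1 \x m2)%E.-integrable setT gh.
  apply/(integrable12ltyP _ _ mgh) => /=.
  rewrite (eq_integral (fun x => `|(g x)%:E| * \int[m2]_y `|(h y)%:E|)%E).
    rewrite ge0_integralZr//; [|exact: measurableT_comp|exact: integral_ge0].
    by apply: lte_mul_pinfty; rewrite ?integral_ge0// ?ge0_fin_numE ?integral_ge0//;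
      [case/integrableP: ig|case/integrableP: ih].
  move=> x _; rewrite -ge0_integralZl//; last exact: measurableT_comp.
  by apply: eq_integral => y _; rewrite -abseM.
have ighZ : P.-integrable setT (gh \o Z).
  case/integrableP : igh => _ igh; apply/integrableP; split.
    exact: measurableT_comp.
  apply: le_lt_trans igh.
  rewrite (@eq_measure_integral _ _ _ _ (distribution P Z)); last first.
    by move=> A mA _; exact: mE.
  by rewrite ge0_integral_distribution//; exact: measurableT_comp.
have -> : ('E_P[fun w => (g (X w) * h (Y w))%R] = \int[m1 \x m2]_z gh z)%E.
  rewrite (@eq_measure_integral _ _ _ _ (distribution P Z)); last first.
    by move=> A mA _; exact: mE.
  by rewrite integral_distribution// unlock.
rewrite -integral12_prod_meas1// /fubini_F.
transitivity (\int[m1]_x ((g x)%:E * \int[m2]_y (h y)%:E))%E.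
  by apply: eq_integral => x _; rewrite -integralZl.
rewrite -(fineK (integrable_fin_num measurableT ih)) integralZr//.
rewrite fineK ?(integrable_fin_num measurableT ih)//.
by rewrite unlock !integral_distribution.
Qed.
End independent_expectation.

(** * The distribution function of a symmetric density *)

Section symmetric_density.
Context (R : realType) (p : R -> R) (M : R).
Local Notation mu := (@lebesgue_measure R).
Local Notation integrable h := (mu.-integrable setT (EFin \o h)).
Hypotheses (p_derivable : forall x, derivable p x 1)
  (p_gt0 : forall x, 0 < p x) (p_even : forall x, p (- x) = p x)
  (p_ub : forall x, p x <= M)
  (p_int1 : (\int[mu]_x (p x)%:E = 1)%E).

Lemma density_continuous : continuous p.
Proof.
by move=> x; exact/differentiable_continuous/derivable1_diffP.
Qed.
Local Hint Resolve density_continuous : core.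

Lemma density_measurable : measurable_fun [set: R] p.
Proof. exact: continuous_measurable_fun. Qed.
Local Hint Resolve density_measurable : core.

Lemma density_integrable : integrable p.
Proof.
apply/integrableP; split; first exact/measurable_EFinP.
under eq_integral do rewrite gee0_abs ?lee_fin ?ltW//.
by rewrite p_int1 ltry.
Qed.

(** The distribution function minus 1/2 is used throughout, because it is odd
    when the density is even. *)
Definition centered_cdf x := \int[mu]_(t in `]-oo, x]) p t - 2^-1.

Lemma centered_cdf_is_derive (x : R) : is_derive x 1 centered_cdf (p x).
Proof.
have xS : x < x + 1 by rewrite ltrDl.
have := @continuous_FTC1 R p -oo%O x (x + 1) xS
  (integrable_itv _ density_integrable) (ltNyr _) (@density_continuous x).
rewrite derive1E.
have -> : centered_cdf = (fun y => \int[mu]_(t in `]-oo, y]) p t) \- cst 2^-1.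
  by [].
set F := (fun y => _); clearbody F => -[dF dFE].
have dF' : is_derive x 1 F (p x) by exact: DeriveDef.
by have := is_deriveB dF' (is_derive_cst (2^-1 : R) x 1); rewrite subr0.
Qed.

Lemma centered_cdf_odd x : centered_cdf (- x) = - centered_cdf x.
Proof.
have ip i := integrable_itv i density_integrable.
have := @Rintegral_itvB R p -oo%O +oo%O x (ip _) isT isT.
rewrite set_itvNyy.
rewrite [X in X - _](_ : _ = 1); last by rewrite /Rintegral p_int1.
rewrite /centered_cdf Rintegral_itv_obnd_cbnd//.
suff -> : \int[mu]_(t in `[x, +oo[) p t = \int[mu]_(t in `]-oo, -x]) p t by lra.
rewrite /Rintegral ge0_integration_by_substitutionNy//.
- by under [in RHS]eq_integral do rewrite /= p_even.
- exact: continuous_subspaceT.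
- by move=> y _; exact: ltW.
Qed.

Lemma centered_cdf_le x : `|centered_cdf x| <= 2^-1.
Proof.
have lb y : - 2^-1 <= centered_cdf y.
  by rewrite lerDr Rintegral_ge0// => t _; exact: ltW.
by rewrite ler_norml lb/= -lerN2 -centered_cdf_odd lb.
Qed.

Lemma density_sqr_integrable : integrable (fun x => p x ^+ 2).
Proof.
apply: (@integrable_le _ _ (fun x => M * p x)).
- exact: measurable_funX.
- move=> x; rewrite normrX ger0_norm ?(ltW (p_gt0 x))// expr2.
  by rewrite ler_wpM2r// ltW.
- exact: (integrableZl measurableT M density_integrable).
Qed.

End symmetric_density.

(** Here [G] stands for [centered_cdf p]. It is kept abstract so that
    its definition as an integral is never unfolded. *)
Section centered_primitive.
Context (R : realType) (p G : R -> R) (M : R).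
Local Notation mu := (@lebesgue_measure R).
Local Notation integrable h := (mu.-integrable setT (EFin \o h)).
Hypotheses (p_derivable : forall x, derivable p x 1)
  (p'_continuous : continuous p^`()%classic)
  (p_gt0 : forall x, 0 < p x) (p_even : forall x, p (- x) = p x)
  (p_ub : forall x, p x <= M)
  (p_int1 : (\int[mu]_x (p x)%:E = 1)%E)
  (G_is_derive : forall x : R, is_derive x 1 G (p x))
  (G_odd : forall x, G (- x) = - G x) (G_le : forall x, `|G x| <= 2^-1).

Let pC := density_continuous p_derivable.
Let pI := density_integrable p_derivable p_gt0 p_int1.

Let dG x : derivable G x 1.
Proof. by have [] := G_is_derive x. Qed.

Let G' : G^`()%classic = p.
Proof. by apply/funext => x; rewrite derive1E derive_val. Qed.

Let GC : continuous G.
Proof. by move=> x; exact/differentiable_continuous/derivable1_diffP. Qed.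

Lemma cvg_centered_cdf : G x @[x --> +oo%R] --> (2^-1 : R).
Proof.
have := cvg_FTC2_symmetric dG.
rewrite G' => /(_ pC pI).
rewrite (_ : \int[mu]_x p x = 1); last by rewrite /Rintegral p_int1.
move=> /(cvgMr_tmp (b := 2^-1)).
under eq_fun do rewrite G_odd opprK.
rewrite mul1r; apply: cvg_trans; apply: near_eq_cvg; apply: nearW => x.
by rewrite /=; lra.
Qed.

Lemma integrable_centered_cdf_M h : integrable h ->
  integrable (fun x => G x * h x).
Proof.
move=> ih; apply: (@integrable_le _ _ (fun x => `|h x|)).
- apply: measurable_funM; first exact: continuous_measurable_fun.
  by apply/measurable_EFinP; exact: measurable_int ih.
- by move=> x; rewrite normrM ler_piMl// (le_trans (G_le x))//; lra.
- exact: integrable_norm.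
Qed.

(** The variance of a uniform variable on [-1/2, 1/2]: [G ^+ 2 * p] is the
    derivative of [G ^+ 3 / 3]. *)
Lemma integral_centered_cdf_sqr : \int[mu]_x (G x ^+ 2 * p x) = 12^-1.
Proof.
pose h x := G x ^+ 3 * 3^-1.
have hD (x : R) : is_derive x 1 h (G x ^+ 2 * p x).
  have -> : h = 3^-1 \*: (G ^+ 3).
    by apply/funext => y; rewrite /h exprfctE /= /GRing.scale/= mulrC.
  apply: (is_derive_eq (is_deriveZ (3^-1) (is_deriveX 3 (G_is_derive x)))).
  by rewrite /GRing.scale/=; field.
have dh x : derivable h x 1 by have [] := hD x.
have h' : h^`()%classic = (fun x => G x ^+ 2 * p x).
  by apply/funext => x; rewrite derive1E derive_val.
have ch' : continuous h^`()%classic.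
  rewrite h' => x; apply: cvgM; last exact: pC.
  exact: (continuous_comp (@GC x) (@exprn_continuous _ 2 _)).
have ih' : integrable h^`()%classic.
  rewrite h'; under eq_fun do rewrite expr2 -mulrA.
  by do 2 apply: integrable_centered_cdf_M; exact: pI.
have hl : h a - h (- a) @[a --> +oo%R] --> (12^-1 : R).
  rewrite (_ : (fun a => _) = (fun a => G a ^+ 3 * (2 / 3))); last first.
    by apply/funext => a; rewrite /h G_odd; field.
  rewrite (_ : 12^-1 = 2^-1 ^+ 3 * (2 / 3) :> R); last by field.
  apply: cvgMr_tmp.
  exact: (cvg_comp _ _ cvg_centered_cdf (@exprn_continuous _ 3 _)).
have := cvg_FTC2_symmetric dh ch' ih'; rewrite h' => hI.
exact: (cvg_unique _ hI hl).
Qed.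

(** Integration by parts: [G * p] is odd and integrable, so the integral of its
    derivative [G * p^`() + p ^+ 2] vanishes. *)
Lemma integral_centered_cdf_derive : integrable p^`()%classic ->
  \int[mu]_x (G x * p^`()%classic x) = - \int[mu]_x (p x ^+ 2).
Proof.
move=> ip'; pose h x := G x * p x.
have dh x : derivable h x 1 by exact: derivableM.
have h' : h^`()%classic = (fun x => G x * p^`()%classic x + p x ^+ 2).
  apply/funext => x; rewrite derive1E deriveM// -!derive1E G'.
  by [].
have i2 := density_sqr_integrable p_derivable p_gt0 p_ub p_int1.
have i1 := integrable_centered_cdf_M ip'.
have ih' : integrable h^`()%classic.
  by rewrite h'; exact: (integrableD measurableT i1 i2).
have ch' : continuous h^`()%classic.
  rewrite h' => x; apply: cvgD.
    by apply: cvgM; [exact: GC|exact: p'_continuous].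
  exact: (continuous_comp (@pC x) (@exprn_continuous _ 2 _)).
have := Rintegral_derive_odd dh ch' ih' (integrable_centered_cdf_M pI).
rewrite h' RintegralD// => /(_ _)/eqP; rewrite addr_eq0 => H; apply/eqP/H.
by move=> x; rewrite /h G_odd p_even mulNr.
Qed.

End centered_primitive.

(** * The second moment, lambda and the Hodges-Lehmann bound *)

Section second_moment_and_lambda.
Context (R : realType) (p : R -> R) (M : R).
Local Notation mu := (@lebesgue_measure R).
Local Notation integrable h := (mu.-integrable setT (EFin \o h)).
Hypotheses (p_derivable : forall x, derivable p x 1)
  (p_gt0 : forall x, 0 < p x)
  (p_ub : forall x, p x <= M)
  (p_int1 : (\int[mu]_x (p x)%:E = 1)%E)
  (p_moment : integrable (fun x => x ^+ 2 * p x)).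

Let pC := density_continuous p_derivable.
Let pI := density_integrable p_derivable p_gt0 p_int1.
Let p2I := density_sqr_integrable p_derivable p_gt0 p_ub p_int1.

Lemma sigma2_gt0 : 0 < sigma2 p.
Proof.
rewrite lt_neqAle Rintegral_ge0 ?andbT; last first.
  by move=> x _; rewrite mulr_ge0 ?sqr_ge0// ltW.
apply/eqP => /esym s0.
have I0 : (\int[mu]_x `|(EFin \o (fun x : R => (x ^+ 2 * p x)%R)) x| = 0)%E.
  transitivity (\int[mu]_x (x ^+ 2 * p x)%:E)%E.
    apply: eq_integral => x _.
    by rewrite gee0_abs// lee_fin mulr_ge0 ?sqr_ge0// ltW.
  by move: (fineK (integrable_fin_num measurableT p_moment)) => <-; congr EFin.
have [N [mN N0 NP]] := (ae_eq_integral_abs mu measurableT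
  (measurable_int mu p_moment)).1 I0.
suff : (mu `[1%R, 2%R] <= 0)%E.
  by rewrite lebesgue_measure_itv/= lte_fin ltr1n -EFinB lee_fin; lra.
rewrite -N0 le_measure ?inE//.
move=> x /=; rewrite in_itv/= => /andP[x1 _]; apply: NP => /= /(_ I)[].
by apply/eqP; rewrite mulf_neq0 ?sqrf_eq0 ?gt_eqF//; lra.
Qed.

(** Substitution y = sigma x. *)
Lemma lambdaE : lambda p = sigma p * \int[mu]_x (p x ^+ 2).
Proof.
have s0 : 0 < sigma p by rewrite sqrtr_gt0 sigma2_gt0.
rewrite /lambda; move: (sigma p) s0 => s s0.
pose F (x : R) := s * x.
have FD (x : R) : is_derive x 1 F s.
  have -> : F = s \*: @id R by [].
  by apply: is_derive_eq; rewrite /GRing.scale/= mulr1.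
have F' : F^`()%classic = cst s by apply/funext => x; rewrite derive1E derive_val.
have dF x : derivable F x 1 by have [] := FD x.
have FC : continuous F.
  by move=> x; exact/differentiable_continuous/derivable1_diffP.
have p2C : continuous (fun x => p x ^+ 2).
  by move=> x; exact: (continuous_comp (@pC x) (@exprn_continuous _ 2 _)).
have E : (\int[mu]_x (p x ^+ 2)%:E = \int[mu]_x (p (F x) ^+ 2 * s)%:E)%E.
  transitivity (\int[mu]_x ((((fun y => p y ^+ 2) \o F) * F^`()%classic) x)%:E)%E.
    apply: increasing_ge0_integration_by_substitutionT.
    - by move=> x y xy; rewrite /F ltr_pM2l.
    - by rewrite F' => x; exact: cvg_cst.
    - by rewrite F'; exact: is_cvg_cst.
    - by rewrite F'; exact: is_cvg_cst.
    - exact: dF.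
    - exact: gt0_cvgMrNy.
    - exact: gt0_cvgMry.
    - exact: p2C.
    - by move=> x; rewrite sqr_ge0.
  by rewrite F'.
rewrite /Rintegral {}E.
have mF : measurable_fun [set: R] (fun x => (p (F x) ^+ 2)%:E).
  apply/measurable_EFinP; apply: continuous_measurable_fun => x.
  exact: (continuous_comp (@FC x) (@p2C (F x))).
under eq_integral do rewrite exprMn EFinM.
rewrite ge0_integralZl ?lee_fin ?sqr_ge0//; last first.
  by move=> x _; rewrite lee_fin sqr_ge0.
under [in RHS]eq_integral do rewrite mulrC EFinM.
rewrite ge0_integralZl ?lee_fin ?(ltW s0)//; last first.
  by move=> x _; rewrite lee_fin sqr_ge0.
rewrite expr2 EFinM -muleA.
move: (integral _ _ _) => X.
have fineMs Y : fine (s%:E * Y)%E = s * fine Y.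
  by case: Y => [r||] //=; rewrite ?gt0_muley ?gt0_muleNy ?lte_fin//= mulr0.
by rewrite fineMs.
Qed.


Lemma lambda_sqrE : lambda p ^+ 2 = sigma2 p * (\int[mu]_x (p x ^+ 2)) ^+ 2.
Proof. by rewrite lambdaE exprMn sqr_sqrtr// ltW// sigma2_gt0. Qed.

Lemma continuous_epanechnikov_sqr (a : R) :
  continuous (fun x : R => (a ^+ 2 - x ^+ 2) ^+ 2).
Proof.
move=> x.
apply: (@continuous_comp _ _ _ (fun y : R => a ^+ 2 - y ^+ 2) (fun y => y ^+ 2)).
  by apply: cvgB; [exact: cvg_cst|exact: exprn_continuous].
exact: exprn_continuous.
Qed.

Lemma Rintegral_epanechnikov_sqr (a : R) : 0 < a ->
  \int[mu]_(x in `[- a, a]) ((a ^+ 2 - x ^+ 2) ^+ 2) = 16 / 15 * a ^+ 5.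
Proof.
move=> a0.
pose Q (x : R) := a ^+ 4 * x - (2 / 3 * a ^+ 2) * x ^+ 3 + 5^-1 * x ^+ 5.
have QD (x : R) : is_derive x 1 Q ((a ^+ 2 - x ^+ 2) ^+ 2).
  have -> : Q = (a ^+ 4 \*: @id R) - ((2 / 3 * a ^+ 2) \*: (@id R ^+ 3))
              + (5^-1 \*: (@id R ^+ 5)).
    by apply/funext => y; rewrite /Q !fctE/= /GRing.scale/=.
  by apply: is_derive_eq; rewrite /GRing.scale/=; field.
have dQ x : derivable Q x 1 by have [] := QD x.
rewrite /Rintegral (@continuous_FTC2 _ _ Q).
- by rewrite /= /Q; field.
- lra.
- by apply: continuous_subspaceT; exact: continuous_epanechnikov_sqr.
- split=> [x _||]; first exact: dQ.
  + apply: cvg_at_right_filter.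
    exact/differentiable_continuous/derivable1_diffP.
  + apply: cvg_at_left_filter.
    exact/differentiable_continuous/derivable1_diffP.
- by move=> x _; rewrite derive1E derive_val.
Qed.

(** The Hodges-Lehmann bound. Among the densities with second moment sigma2, the
    integral of p^2 is least for the Epanechnikov density
    e(x) = b (a^2 - x^2) on [-a, a], with a^2 = 5 sigma2 and b = 3 / (4 a^3).
    On [-a, a] one has p^2 >= 2 p e - e^2, as the difference is a square;
    outside, p^2 >= 0 >= 2 b (a^2 - x^2) p. Hence p^2 is everywhere above the
    function k - r of the proof, whose integral depends on p only through its
    mass and its second moment, and equals 3 / (5 a). *)
Lemma lambda_sqr_ge : 9 / 125 <= lambda p ^+ 2.
Proof.
have s2 := sigma2_gt0.
pose a := Num.sqrt (5 * sigma2 p).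
have a2 : a ^+ 2 = 5 * sigma2 p by rewrite sqr_sqrtr// mulr_ge0// ltW.
have a0 : 0 < a by rewrite sqrtr_gt0 mulr_gt0.
pose b := 3 / (4 * a ^+ 3).
have b0 : 0 < b by rewrite divr_gt0// mulr_gt0// exprn_gt0.
pose q (x : R) := b ^+ 2 * (a ^+ 2 - x ^+ 2) ^+ 2.
pose k (x : R) := (2 * b * a ^+ 2) * p x - (2 * b) * (x ^+ 2 * p x).
pose r := q \_ `[- a, a].
have kI1 : integrable (fun x => (2 * b * a ^+ 2) * p x).
  exact: (integrableZl measurableT (2 * b * a ^+ 2) pI).
have kI2 : integrable (fun x => (2 * b) * (x ^+ 2 * p x)).
  exact: (integrableZl measurableT (2 * b) p_moment).
have kI : integrable k.
  exact: (integrableB measurableT kI1 kI2).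
have mp_itv : measurable (`[- a, a]%classic : set (measurableTypeR R)).
  exact: measurable_itv.
have qI : mu.-integrable `[- a, a] (EFin \o (fun x : R => (a ^+ 2 - x ^+ 2) ^+ 2)).
  apply: continuous_compact_integrable; first exact: segment_compact.
  by apply: continuous_subspaceT; exact: continuous_epanechnikov_sqr.
have rI : integrable r.
  have := (integrable_mkcond _ mp_itv).1 (integrableZl mp_itv (b ^+ 2) qI).
  by rewrite -restrict_EFin.
have kE : \int[mu]_x k x = 2 * b * a ^+ 2 - 2 * b * sigma2 p.
  rewrite /k RintegralB// !RintegralZl//.
  by rewrite [\int[mu]_x p x]/Rintegral p_int1 mulr1.
have rE : \int[mu]_x r x = b ^+ 2 * (16 / 15 * a ^+ 5).
  by rewrite -Rintegral_mkcond /q RintegralZl ?Rintegral_epanechnikov_sqr.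
have : \int[mu]_x (k x - r x) <= \int[mu]_x (p x ^+ 2).
  apply: le_Rintegral => //; first exact: (integrableB measurableT kI rI).
  move=> x _; rewrite /r patchE; case: ifPn => [_|].
    rewrite -subr_ge0 (_ : _ - _ = (p x - b * (a ^+ 2 - x ^+ 2)) ^+ 2) ?sqr_ge0//.
    by rewrite /k /q; ring.
  rewrite subr0 notin_setE/= in_itv/= => /negP; rewrite -ler_norml -ltNge => ax.
  rewrite (@le_trans _ _ 0) ?sqr_ge0//.
  rewrite (_ : k x = (2 * b * p x) * (a ^+ 2 - x ^+ 2)); last by rewrite /k; ring.
  rewrite mulr_ge0_le0//; first by have := mulr_gt0 b0 (p_gt0 x); lra.
  rewrite subr_le0 -[x ^+ 2]real_normK ?num_real// ler_sqr ?nnegrE//; lra.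
have sE : sigma2 p = a ^+ 2 / 5 by rewrite a2; field.
rewrite (RintegralB measurableT kI rI) kE rE sE => H; rewrite lambda_sqrE.
have {}H : 3 / (5 * a) <= \int[mu]_x p x ^+ 2.
  apply: le_trans H; rewrite le_eqVlt; apply/orP; left; apply/eqP.
  by rewrite /b; field; rewrite gt_eqF.
rewrite (_ : 9 / 125 = sigma2 p * (3 / (5 * a)) ^+ 2).
  rewrite ler_pM2l// ler_sqr// nnegrE; [|apply: le_trans H];
  by rewrite divr_ge0// mulr_ge0// ltW.
rewrite sE.
by field; rewrite gt_eqF.
Qed.

End second_moment_and_lambda.

(** * Gaussian densities *)

Section gaussian.
Context (R : realType) (p : R -> R).
Local Notation mu := (@lebesgue_measure R).
Local Notation integrable h := (mu.-integrable setT (EFin \o h)).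
Hypotheses (p_derivable : forall x, derivable p x 1)
  (p_gt0 : forall x, 0 < p x) (p_even : forall x, p (- x) = p x)
  (p_int1 : (\int[mu]_x (p x)%:E = 1)%E)
  (p_moment : integrable (fun x => x ^+ 2 * p x)).

Let pC := density_continuous p_derivable.
Let pI := density_integrable p_derivable p_gt0 p_int1.

Lemma even_gaussian_centered : gaussian_density p ->
  exists2 s : R, 0 < s & p = normal_pdf 0 s.
Proof.
move=> [m [s [s0 pE]]]; exists s => //; rewrite pE; congr normal_pdf.
have := p_even m; rewrite pE normal_pdfE ?gt_eqF//.
move=> /(mulfI (lt0r_neq0 (normal_peak_gt0 (lt0r_neq0 s0))))/expR_inj.
rewrite subrr expr0n/= oppr0 mul0r => /eqP.
rewrite mulf_eq0 oppr_eq0 sqrf_eq0 invr_eq0 mulrn_eq0/= sqrf_eq0 (gt_eqF s0) orbF.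
by rewrite -opprD oppr_eq0 -mulr2n mulrn_eq0/= => /eqP.
Qed.

(** With [h x = x * p x] one has [h^`() x = p x - x ^+ 2 * p x / s ^+ 2], and
    [h] is odd and integrable. *)
Lemma gaussian_sigma2 s : 0 < s -> p = normal_pdf 0 s -> sigma2 p = s ^+ 2.
Proof.
move=> s0 pE.
have sn0 : s != 0 by rewrite gt_eqF.
have pD (x : R) : is_derive x 1 p (- (x / s ^+ 2) * p x).
  rewrite pE normal_pdfE//.
  pose g : R -> R := (- (s ^+ 2 *+ 2)^-1) \*: (@id R ^+ 2).
  have gE y : g y = - y ^+ 2 / (s ^+ 2 *+ 2).
    by rewrite /g fctE /GRing.scale/= mulNr mulrC -mulNr.
  have gD : is_derive x 1 g (- (x / s ^+ 2)).
    by apply: is_derive_eq; rewrite /GRing.scale/=; field.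
  have -> : (fun y : R => normal_peak s * normal_fun 0 s y) =
            normal_peak s \*: (expR \o g).
    by apply/funext => y; rewrite /normal_fun subr0 -gE.
  have eD := is_derive1_comp (is_derive_expR (g x)) gD.
  apply: (is_derive_eq (is_deriveZ (normal_peak s) eD)).
  rewrite /normal_fun subr0 -gE /GRing.scale/=; ring.
have dp x : derivable p x 1 by have [] := pD x.
pose h (x : R) := x * p x.
have hD (x : R) : is_derive x 1 h (p x - (s ^+ 2)^-1 * (x ^+ 2 * p x)).
  apply: (is_derive_eq (is_deriveM (is_derive_id x 1) (pD x))).
  by rewrite /GRing.scale/=; field.
have dh x : derivable h x 1 by have [] := hD x.
have h' : h^`()%classic = (fun x => p x - (s ^+ 2)^-1 * (x ^+ 2 * p x)).
  by apply/funext => x; rewrite derive1E derive_val.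
have i2 : integrable (fun x => (s ^+ 2)^-1 * (x ^+ 2 * p x)).
  exact: (integrableZl measurableT (s ^+ 2)^-1 p_moment).
have ih' : integrable h^`()%classic.
  by rewrite h'; exact: (integrableB measurableT pI i2).
have ch' : continuous h^`()%classic.
  rewrite h' => x; apply: cvgB; first exact: pC.
  apply: cvgM; first exact: cvg_cst.
  by apply: cvgM; [exact: exprn_continuous|exact: pC].
have ih : integrable h.
  apply: (@integrable_le _ _ (fun x => p x + x ^+ 2 * p x)).
  - apply: continuous_measurable_fun => x.
    by apply: cvgM; [exact: cvg_id|exact: pC].
  - move=> x; rewrite normrM (gtr0_norm (p_gt0 x)) -[X in X + _]mul1r -mulrDl ler_wpM2r//.
      exact: ltW.
    by rewrite -[x ^+ 2]real_normK ?num_real//; have := sqr_ge0 (`|x| - 1); nra.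
  - exact: (integrableD measurableT pI p_moment).
have := Rintegral_derive_odd dh ch' ih' ih.
rewrite h' (RintegralB measurableT pI i2) RintegralZl//.
rewrite [\int[mu]_x p x]/Rintegral p_int1 -/(sigma2 p) => /(_ _)/eqP.
rewrite subr_eq0 => H.
have /eqP : 1 == (s ^+ 2)^-1 * sigma2 p.
  by apply: H => x; rewrite /h p_even mulNr.
by move=> E; rewrite -[RHS]mulr1 [in RHS]E mulrA divff ?mul1r// sqrf_eq0.
Qed.

(** The square of the Gaussian density of scale s is a multiple of the one of
    scale s / sqrt 2, whose integral is 1. *)
Lemma gaussian_Rintegral_sqr s : 0 < s -> p = normal_pdf 0 s ->
  (\int[mu]_x (p x ^+ 2)) ^+ 2 = (4 * pi * s ^+ 2)^-1.
Proof.
move=> s0 pE.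
pose s' := s / Num.sqrt 2.
have s'2 : s' ^+ 2 *+ 2 = s ^+ 2.
  by rewrite /s' expr_div_n sqr_sqrtr// -mulr_natr divfK.
have s'0 : s' != 0 by rewrite mulf_neq0 ?gt_eqF// invr_gt0 sqrtr_gt0.
have npE (t y : R) : t != 0 -> normal_pdf 0 t y = normal_peak t * normal_fun 0 t y.
  by move=> t0; rewrite normal_pdfE.
have E x : p x ^+ 2 = (normal_peak s ^+ 2 / normal_peak s') * normal_pdf 0 s' x.
  rewrite pE (npE s) ?gt_eqF// (npE s' x s'0) exprMn mulrA divfK; last first.
    by rewrite gt_eqF// normal_peak_gt0.
  congr (_ * _); rewrite /normal_fun -expRM_natl s'2; congr expR.
  by field; rewrite gt_eqF.
under eq_Rintegral do rewrite E.
rewrite RintegralZl//; last exact: integrable_normal_pdf.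
rewrite [\int[mu]_x _]/Rintegral integral_normal_pdf mulr1.
rewrite /normal_peak invrK exprMn exprVn sqr_sqrtr; last first.
  by rewrite mulrn_wge0// mulr_ge0 ?sqr_ge0 ?pi_ge0.
rewrite (_ : s' ^+ 2 * pi *+ 2 = s ^+ 2 * pi); last by rewrite -mulrnAl s'2.
rewrite sqr_sqrtr; last by rewrite mulr_ge0 ?sqr_ge0 ?pi_ge0.
(* [pi] is generalized because [field] would unfold its definition. *)
have := pi_gt0 R; move: (@pi R) => c c0.
by field; rewrite (gt_eqF s0) gt_eqF.
Qed.

Lemma gaussian_lambda_sqr : gaussian_density p -> lambda p ^+ 2 = (4 * pi)^-1.
Proof.
move=> /even_gaussian_centered[s s0 pE].
rewrite (lambda_sqrE p_derivable p_gt0 p_moment).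
rewrite (gaussian_sigma2 s0 pE) (gaussian_Rintegral_sqr s0 pE).
have := pi_gt0 R; move: (@pi R) => c c0.
by field; rewrite (gt_eqF s0) gt_eqF.
Qed.

End gaussian.

(** * Products under the Lebesgue measure, and product densities *)

Section lebesgue_tuple_product.
Context (R : realType).
Local Notation mu := (@lebesgue_measure R).

Lemma measurable_prod_tnth n (g : 'I_n -> R -> R) :
  (forall i, measurable_fun [set: R] (g i)) ->
  measurable_fun [set: n.-tuple (measurableTypeR R)]
    (fun t => \prod_(i < n) g i (tnth t i)).
Proof.
move=> mg; apply: measurable_prod => i _.
by apply: measurableT_comp (mg i) _; exact: measurable_tnth.
Qed.

(** Tonelli's theorem, by induction on the dimension. *)
Lemma ge0_integral_lebesgue_tuple_prod n (g : 'I_n -> R -> R) :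
  (forall i, measurable_fun [set: R] (g i)) ->
  (forall i x, 0 <= g i x) ->
  (\int[lebesgue_tuple R n]_t (\prod_(i < n) g i (tnth t i))%:E =
   \prod_(i < n) \int[mu]_x (g i x)%:E)%E.
Proof.
elim: n g => [|n IH] g mg g0.
  rewrite [RHS]big_ord0 /= integral_dirac//=; last first.
    by apply/measurable_EFinP; exact: measurable_prod_tnth.
  by rewrite diracT mul1e big_ord0.
rewrite big_ord_recl -(IH (fun i => g (lift ord0 i)))//.
rewrite /= /lebesgue_tupleS.
rewrite ge0_integral_pushforward//; last first.
- by move=> t _; rewrite lee_fin prodr_ge0.
- by apply/measurable_EFinP; exact: measurable_prod_tnth.
- exact: measurable_tuple_cons.
have mg' := measurable_prod_tnth (fun i => mg (lift ord0 i)).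
pose h (z : measurableTypeR R * n.-tuple (measurableTypeR R)) :=
  ((g ord0 z.1)%:E * (\prod_(i < n) g (lift ord0 i) (tnth z.2 i))%:E)%E.
transitivity (\int[mu \x lebesgue_tuple R n]_z h z)%E.
  apply: eq_integral => -[x t] _ /=.
  rewrite big_ord_recl /h /= -EFinM; congr (_ * _)%:E.
  by apply: eq_bigr => i _; rewrite tnthS.
rewrite fubini_tonelli1//; last 2 first.
- apply/measurable_EFinP; apply: measurable_funM.
    exact: measurableT_comp (mg ord0) measurable_fst.
  exact: measurableT_comp mg' measurable_snd.
- by move=> z; rewrite mule_ge0// lee_fin ?prodr_ge0.
rewrite -ge0_integralZr//.
- apply: eq_integral => x _; rewrite /fubini_F /h/= ge0_integralZl//.
  + by apply/measurable_EFinP; exact: mg'.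
  + by move=> t _; rewrite lee_fin prodr_ge0.
  + by rewrite lee_fin.
- by apply: measurableT_comp => //; exact: mg.
- by move=> x _; rewrite lee_fin.
- by apply: integral_ge0 => t _; rewrite lee_fin prodr_ge0.
Qed.

End lebesgue_tuple_product.

Section product_density.
Context (R : realType) (K : nat) (f : 'cV[R]_K -> R).
Local Notation mu := (@lebesgue_measure R).
Hypotheses (f_pdf : is_pdf f) (f_sym : forall x : 'cV[R]_K, f (- x) = f x)
  (f_pos : forall x, 0 < f x) (f_C1 : continuously_differentiable f)
  (f_marg_bounded : forall k, exists M : R, forall y, (marginal f k y <= M%:E)%E)
  (f_prod : forall x, f x = \prod_(k < K) marginal_density f k (x k 0)).
Implicit Types k l : 'I_K.
Local Notation g := (marginal_density f).

Lemma marginal_ge0 k y : (0 <= marginal f k y)%E.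
Proof. by apply: integral_ge0 => t _; rewrite lee_fin ltW. Qed.

Lemma marginal_density_gt0 k y : 0 < g k y.
Proof.
rewrite lt0r fine_ge0 ?marginal_ge0// andbT.
have := lt0r_neq0 (f_pos (const_mx y)).
rewrite f_prod (bigD1 k)//= mulf_eq0 negb_or => /andP[+ _].
by rewrite mxE.
Qed.

Lemma marginal_densityE k y : marginal f k y = (g k y)%:E.
Proof.
have [M leM] := f_marg_bounded k.
rewrite fineK// ge0_fin_numE ?marginal_ge0//.
exact: le_lt_trans (leM y) (ltry M).
Qed.

Lemma marginal_density_ub k : exists M : R, forall y, g k y <= M.
Proof.
have [M leM] := f_marg_bounded k.
by exists M => y; rewrite -lee_fin -marginal_densityE.
Qed.

Lemma prod_line (x : 'cV[R]_K) k (h : R) :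
  f (h *: delta_mx k 0 + x) =
  g k (h + x k 0) * \prod_(j < K | j != k) g j (x j 0).
Proof.
rewrite f_prod (bigD1 k)//= !mxE !eqxx mulr1; congr (_ * _).
by apply: eq_bigr => j jk; rewrite !mxE (negbTE jk) mulr0 add0r.
Qed.

Let c k : R := \prod_(j < K | j != k) g j 0.

Let c_gt0 k : 0 < c k.
Proof. by apply: prodr_gt0 => j _; exact: marginal_density_gt0. Qed.

(** Along a coordinate axis, [f] is a marginal density up to a positive
    constant; the regularity and symmetry of the marginals come from those of
    [f] in this way, without differentiating under an integral sign. *)
Lemma marginal_density_line k y : g k y = (c k)^-1 * f (y *: delta_mx k 0).
Proof.
rewrite -[y *: _]addr0 prod_line mxE addr0.
rewrite (eq_bigr (fun j => g j 0)); last by move=> j _; rewrite mxE.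
by rewrite mulrC mulfK// gt_eqF// c_gt0.
Qed.

Lemma marginal_density_even k y : g k (- y) = g k y.
Proof. by rewrite !marginal_density_line scaleNr f_sym. Qed.

Lemma marginal_density_is_derive k (y : R) :
  is_derive y 1 (g k) ((c k)^-1 * gradient f (y *: delta_mx k 0) k 0).
Proof.
have [df _] := f_C1.
have : derivable f (y *: delta_mx k 0) (delta_mx k 0) by exact: diff_derivable.
move=> dfy.
have fl : is_derive y 1 (fun z : R => f (z *: delta_mx k 0))
    (gradient f (y *: delta_mx k 0) k 0).
  have E : (fun h : R => h^-1 *: (((fun z : R => f (z *: delta_mx k 0)) \o shift y)
      (h *: 1) - f (y *: delta_mx k 0))) =
    (fun h : R => h^-1 *: ((f \o shift (y *: delta_mx k 0)) (h *: delta_mx k 0)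
      - f (y *: delta_mx k 0))).
    by apply/funext => h /=; rewrite scalerDl /GRing.scale/= mulr1.
  by apply: DeriveDef; rewrite ?mxE /derivable /derive E.
have -> : g k = (c k)^-1 \*: (fun z : R => f (z *: delta_mx k 0)).
  by apply/funext => z; rewrite marginal_density_line.
exact: is_deriveZ.
Qed.

Lemma marginal_density_derivable k x : derivable (g k) x 1.
Proof. by have [] := marginal_density_is_derive k x. Qed.

Lemma marginal_density_derive_continuous k : continuous (g k)^`()%classic.
Proof.
have [_ cf] := f_C1.
have -> : (g k)^`()%classic =
    (fun y => (c k)^-1 * gradient f (y *: delta_mx k 0) k 0).
  apply/funext => y; rewrite derive1E.
  by have [_ ->] := marginal_density_is_derive k y.
move=> y; apply: cvgM; first exact: cvg_cst.
apply: (@continuous_comp _ _ _ (fun y : R => y *: delta_mx k 0 : 'cV[R]_K)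
  (fun x => gradient f x k 0)).
  exact: scalel_continuous.
apply: (@continuous_comp _ _ _ (gradient f) (fun x : 'cV[R]_K => x k 0)).
  exact: cf.
exact: coord_continuous.
Qed.

Lemma marginal_density_continuous k : continuous (g k).
Proof. exact: density_continuous (@marginal_density_derivable k). Qed.

Lemma marginal_density_measurable k : measurable_fun [set: R] (g k).
Proof. by apply: continuous_measurable_fun; exact: marginal_density_continuous. Qed.


Let g0 k y : 0 <= g k y. Proof. by rewrite ltW ?marginal_density_gt0. Qed.

Lemma integral_pdf_box (B : 'I_K -> set (measurableTypeR R)) :
  (forall k, measurable (B k)) ->
  (\int[lebesgue_tuple R K]_(t in [set t | forall k, B k (tnth t k)])
     (f (col_of_tuple t))%:E = \prod_(k < K) \int[mu]_(x in B k) (g k x)%:E)%E.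
Proof.
move=> mB; rewrite integral_mkcond.
have mgB k : measurable_fun [set: R] (g k \_ (B k)).
  apply: (measurable_restrictT (g k) (mB k)).1.
  by apply: measurable_funTS; exact: marginal_density_measurable.
transitivity (\int[lebesgue_tuple R K]_t
    (\prod_(k < K) (g k \_ (B k)) (tnth t k))%:E)%E.
  apply: eq_integral => t _; rewrite patchE; case: ifPn => [|].
    rewrite inE/= => tB; rewrite f_prod; congr EFin; apply: eq_bigr => k _.
    by rewrite patchE mem_set// mxE.
  rewrite notin_setE/= => /existsNP[k Bk].
  by rewrite (bigD1 k)//= patchE memNset// mul0r.
rewrite (ge0_integral_lebesgue_tuple_prod (g := fun k => g k \_ (B k)))//; last first.
  by move=> k x; rewrite patchE; case: ifP.
apply: eq_bigr => k _; rewrite [RHS]integral_mkcond.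
by apply: eq_integral => x _; rewrite !patchE; case: ifP.
Qed.

Lemma integral_marginal_density_prod :
  (\prod_(k < K) \int[mu]_x (g k x)%:E = 1)%E.
Proof.
have [_ _ f1] := f_pdf; rewrite -[RHS]f1.
apply: (etrans (esym (@integral_pdf_box (fun=> setT) (fun=> measurableT)))).
by congr integral; apply/seteqP; split.
Qed.

(** Integrating the product formula for [f] over the coordinates other than [k]
    gives back the k-th marginal multiplied by the masses of the other ones, so
    the product of these masses is 1; and so is the product of all masses. *)
Lemma integral_marginal_density k : (\int[mu]_x (g k x)%:E = 1)%E.
Proof.
have I0 j : (0 <= \int[mu]_x (g j x)%:E)%E.
  by apply: integral_ge0 => x _; rewrite lee_fin.
have : marginal f k 0 =
   ((g k 0)%:E * \prod_(i < K.-1) \int[mu]_x (g (lift k i) x)%:E)%E.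
  rewrite /marginal -(ge0_integral_lebesgue_tuple_prod (g := fun i => g (lift k i)))//; last first.
    by move=> i; exact: marginal_density_measurable.
  rewrite -ge0_integralZl ?lee_fin//; last 2 first.
  - apply/measurable_EFinP; apply: (measurable_prod_tnth (g := fun i => g (lift k i))) => i.
    exact: marginal_density_measurable.
  - by move=> t _; rewrite lee_fin prodr_ge0.
  apply: eq_integral => t _; rewrite f_prod (bigD1_ord k)//= EFinM.
  congr (_ * _%:E)%E; first by rewrite mxE unlift_none.
  by apply: eq_bigr => i _; rewrite mxE liftK.
rewrite marginal_densityE => E.
have {}E : (\prod_(i < K.-1) \int[mu]_x (g (lift k i) x)%:E = 1)%E.
  have gk0 := marginal_density_gt0 k 0.
  rewrite -[LHS]mul1e -[X in (X%:E * _)%E](mulVf (lt0r_neq0 gk0)) EFinM -muleA -E.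
  by rewrite -EFinM mulVf// gt_eqF.
have := integral_marginal_density_prod.
by rewrite (bigD1_ord k)//= E mule1.
Qed.

End product_density.

(** * Independence of the coordinates *)

Section law_of_product_density.
Context (R : realType) (K : nat) (f : 'cV[R]_K -> R).
Local Notation mu := (@lebesgue_measure R).
Local Notation RR := (measurableTypeR R).
Hypotheses (f_pdf : is_pdf f) (f_pos : forall x, 0 < f x)
  (f_C1 : continuously_differentiable f)
  (f_marg_bounded : forall k, exists M : R, forall y, (marginal f k y <= M%:E)%E)
  (f_prod : forall x, f x = \prod_(k < K) marginal_density f k (x k 0)).
Context (d : measure_display) (T : measurableType d) (P : probability T R)
  (X : 'I_K -> {RV P >-> R}).
Hypothesis X_density : has_density P X f.
Implicit Types k l : 'I_K.
Local Notation g := (marginal_density f).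

Lemma prob_box (B : 'I_K -> set RR) : (forall k, measurable (B k)) ->
  P [set w | forall k, B k (X k w)] =
  (\prod_(k < K) \int[mu]_(x in B k) (g k x)%:E)%E.
Proof.
move=> mB; pose box := [set t : K.-tuple RR | forall k, B k (tnth t k)].
have mbox : measurable box.
  rewrite (_ : box = \bigcap_(k in [set: 'I_K])
      ((@tnth K RR)^~ k @^-1` B k)).
    apply: fin_bigcap_measurable; [exact: finite_finset|move=> k _].
    by rewrite -[X in measurable X]setTI; exact: measurable_tnth.
  by apply/seteqP; split=> [t Ct k _|t Ct k]; exact: Ct.
rewrite -(integral_pdf_box f_pos f_C1 f_prod mB) -(X_density mbox).
congr (P _); apply/seteqP; split=> w /= wB k; first by rewrite tnth_mktuple.
by have := wB k; rewrite tnth_mktuple.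
Qed.

Lemma prob_pair k l (A B : set RR) : k != l -> measurable A -> measurable B ->
  P (X k @^-1` A `&` X l @^-1` B) =
  (\int[mu]_(x in A) (g k x)%:E * \int[mu]_(x in B) (g l x)%:E)%E.
Proof.
move=> kl mA mB.
pose C j := if j == k then A else if j == l then B else setT.
have mC j : measurable (C j) by rewrite /C; case: ifP => // _; case: ifP.
have Ck : C k = A by rewrite /C eqxx.
have Cl : C l = B by rewrite /C eq_sym (negbTE kl) eqxx.
rewrite (_ : _ `&` _ = [set w | forall j, C j (X j w)]).
  rewrite prob_box// (bigD1 k)//= (bigD1 l)/=; last by rewrite eq_sym.
  rewrite big1 => [|j /andP[jk jl]]; last first.
    rewrite /C (negbTE jk) (negbTE jl).
    exact: (integral_marginal_density f_pdf f_pos f_C1 f_marg_bounded f_prod).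
  by rewrite Ck Cl; congr (_ * _)%E; rewrite mule1.
apply/seteqP; split=> w /=.
  move=> [Aw Bw] j; rewrite /C; case: eqP => [->//|_].
  by case: eqP => [->//|_].
move=> H; split; first by have := H k; rewrite /C eqxx.
by have := H l; rewrite /C eq_sym (negbTE kl) eqxx.
Qed.

Lemma prob_marginal k (A : set RR) : measurable A ->
  P (X k @^-1` A) = (\int[mu]_(x in A) (g k x)%:E)%E.
Proof.
move=> mA.
pose C j := if j == k then A else setT.
have mC j : measurable (C j) by rewrite /C; case: ifP.
rewrite (_ : _ @^-1` _ = [set w | forall j, C j (X j w)]).
  rewrite prob_box// (bigD1 k)//= big1 => [|j jk]; last first.
    rewrite /C (negbTE jk).
    exact: (integral_marginal_density f_pdf f_pos f_C1 f_marg_bounded f_prod).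
  by rewrite mule1 /C eqxx.
apply/seteqP; split=> w /=.
  by move=> Aw j; rewrite /C; case: eqP => [->|].
by move=> /(_ k); rewrite /C eqxx.
Qed.

Lemma prob_indep k l (A B : set R) : k != l -> measurable A -> measurable B ->
  P (X k @^-1` A `&` X l @^-1` B) = (P (X k @^-1` A) * P (X l @^-1` B))%E.
Proof. by move=> kl mA mB; rewrite prob_pair// !prob_marginal. Qed.

Lemma expectation_marginal k (h : R -> R) : measurable_fun [set: R] h ->
  P.-integrable setT (EFin \o (h \o X k)) ->
  mu.-integrable setT (EFin \o (fun x => h x * g k x)) /\
  ('E_P[h \o X k] = \int[mu]_x (h x * g k x)%:E)%E.
Proof.
move=> mh ih.
have mX : measurable_fun [set: T] (X k : T -> RR) .
  by move=> _ A mA; exact: (measurable_funP (X k) measurableT A mA).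
(* [Z] is [X k] seen in the copy of [R] that carries the Lebesgue measure. *)
pose Zm := isMeasurableFun.Build _ _ _ _ _ mX.
pose Z : {RV P >-> RR} := HB.pack (X k : T -> RR) Zm.
have g0 x : 0 <= g k x by rewrite ltW// marginal_density_gt0.
have mg := marginal_density_measurable f_pos f_C1 f_prod k.
have lawE A : measurable A -> distribution P Z A = (\int[mu]_(x in A) (g k x)%:E)%E.
  exact: prob_marginal.
have inu : (distribution P Z).-integrable setT (EFin \o h).
  by apply: integrable_pushforward => //; exact/measurable_EFinP.
split; first exact: (@integrable_density _ RR R mu (distribution P Z) (g k)).
rewrite -(@integral_density _ RR R mu (distribution P Z) (g k))// unlock.
symmetry; apply: (@integral_distribution _ _ T RR R P Z (EFin \o h)) => //.
by apply: measurableT_comp.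
Qed.

End law_of_product_density.

(** * The matrices C, Sigma and A *)

Section moments_of_product_density.
Context (R : realType) (K : nat) (f : 'cV[R]_K -> R).
Local Notation mu := (@lebesgue_measure R).
Hypotheses (f_pdf : is_pdf f) (f_sym : forall x : 'cV[R]_K, f (- x) = f x)
  (f_pos : forall x, 0 < f x) (f_C1 : continuously_differentiable f)
  (f_marg_bounded : forall k, exists M : R, forall y, (marginal f k y <= M%:E)%E)
  (f_prod : forall x, f x = \prod_(k < K) marginal_density f k (x k 0)).
Context (d : measure_display) (T : measurableType d) (P : probability T R)
  (X : 'I_K -> {RV P >-> R}).
Hypothesis X_density : has_density P X f.
Implicit Types k l : 'I_K.
Local Notation g := (marginal_density f).
Local Notation F k := (centered_cdf (g k)).
Local Notation integrable h := (P.-integrable setT (EFin \o h)).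

Let lawX := expectation_marginal f_pdf f_pos f_C1 f_marg_bounded f_prod X_density.
Let g_even := marginal_density_even f_sym f_pos f_prod.
Let g_int1 := integral_marginal_density f_pdf f_pos f_C1 f_marg_bounded f_prod.

Lemma expectation_marginal_odd k (h : R -> R) : measurable_fun [set: R] h ->
  (forall x, h (- x) = - h x) -> integrable (h \o X k) ->
  ('E_P[h \o X k] = 0)%E.
Proof.
move=> mh oh ih; have [ihg ->] := lawX mh ih.
by apply: integral_odd => // x; rewrite oh g_even mulNr.
Qed.

(** This makes the off-diagonal entries of the three matrices vanish. *)
Lemma expectation_marginal_pair_odd k l (h1 h2 : R -> R) : k != l ->
  measurable_fun [set: R] h1 -> measurable_fun [set: R] h2 ->
  (forall x, h1 (- x) = - h1 x) ->
  integrable (h1 \o X k) -> integrable (h2 \o X l) ->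
  ('E_P[fun w => (h1 (X k w) * h2 (X l w))%R] = 0)%E.
Proof.
move=> kl m1 m2 o1 i1 i2.
rewrite (expectation_indep_prod _ m1 m2 i1 i2).
  by rewrite expectation_marginal_odd// mul0e.
move=> A B mA mB.
exact: (prob_indep f_pdf f_pos f_C1 f_marg_bounded f_prod X_density).
Qed.

(** The covariance matrix is the case [a = 0], [h = id], and that of the
    [F_k(X_k)] is the case [a = 1/2], [h = centered_cdf]. *)
Lemma covariance_odd (a : R) (h : 'I_K -> R -> R) k l :
  (forall j, measurable_fun [set: R] (h j)) ->
  (forall j x, h j (- x) = - h j x) ->
  (forall j, integrable (h j \o X j)) ->
  integrable ((fun x => h k x ^+ 2) \o X k) ->
  fine (covariance P (fun w => a + h k (X k w)) (fun w => a + h l (X l w))) =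
  (\int[mu]_x (h k x ^+ 2 * g k x)) *+ (k == l).
Proof.
move=> mh oh ih ihh.
have mean j : ('E_P[fun w => (a + h j (X j w))%R] = a%:E)%E.
  have ia : integrable (cst a) by exact: finite_measure_integrable_cst.
  rewrite unlock (integralD_EFin measurableT ia (ih j)).
  have := expectation_cst P a; rewrite unlock => ->.
  have := expectation_marginal_odd (mh j) (oh j) (ih j).
  by rewrite unlock => ->; rewrite adde0.
rewrite covariance.unlock !mean /=.
transitivity (fine 'E_P[fun w => (h k (X k w) * h l (X l w))%R])%E.
  congr fine; congr expectation; apply/funext => w; rewrite !fctE /=; ring.
have [<-|kl] := eqVneq k l; last first.
  by rewrite expectation_marginal_pair_odd.
have msq : measurable_fun [set: R] (fun x => h k x ^+ 2) by exact: measurable_funX.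
have [_ E] := lawX msq ihh.
by rewrite mulr1n /Rintegral -E.
Qed.


Lemma integrable_of_sqr (Y : T -> R) : measurable_fun [set: T] Y ->
  integrable (fun w => Y w ^+ 2) -> integrable Y.
Proof.
move=> mY iY2.
have i1 : integrable (cst 1%R) by exact: finite_measure_integrable_cst.
apply: le_integrable (integrableD measurableT i1 iY2) => //.
  exact/measurable_EFinP.
move=> w _ /=; rewrite lee_fin [leRHS]ger0_norm ?addr_ge0 ?sqr_ge0//.
by rewrite -[Y w ^+ 2]real_normK ?num_real//; have := sqr_ge0 (`|Y w| - 1); nra.
Qed.

Lemma integrable_of_bounded (c : R) (Y : T -> R) : measurable_fun [set: T] Y ->
  (forall w, `|Y w| <= c) -> integrable Y.
Proof.
move=> mY Yc.
have ic : integrable (cst c) by exact: finite_measure_integrable_cst.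
apply: le_integrable ic => //; first exact/measurable_EFinP.
by move=> w _; rewrite /= lee_fin (le_trans (Yc w))// ler_norm.
Qed.

Let g_derivable k := marginal_density_derivable f_pos f_C1 f_prod (k := k).
Let g'_continuous k := marginal_density_derive_continuous f_pos f_C1 f_prod (k := k).
Let g_gt0 k := marginal_density_gt0 f_pos f_prod k.

Lemma cdf_transformE k w : cdf_transform X k w = 2^-1 + F k (X k w).
Proof.
rewrite /cdf_transform /cdf /distribution /pushforward.
rewrite (prob_marginal f_pdf f_pos f_C1 f_marg_bounded f_prod X_density).
  by rewrite /centered_cdf /Rintegral addrC subrK.
exact: measurable_itv.
Qed.

Let F_is_derive k (x : R) : is_derive x 1 (F k) (g k x).
Proof.
exact: (centered_cdf_is_derive (g_derivable (k := k)) (@g_gt0 k) (g_int1 k)).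
Qed.

Let F_measurable k : measurable_fun [set: R] (F k).
Proof.
apply: continuous_measurable_fun => x.
apply/differentiable_continuous/derivable1_diffP.
by have [] := F_is_derive k x.
Qed.

Let F_odd k x : F k (- x) = - F k x.
Proof.
exact: (centered_cdf_odd (g_derivable (k := k)) (@g_gt0 k) (@g_even k)
  (g_int1 k)).
Qed.

Let F_le k x : `|F k x| <= 2^-1.
Proof.
exact: (centered_cdf_le (g_derivable (k := k)) (@g_gt0 k) (@g_even k)
  (g_int1 k)).
Qed.

Lemma Sigma_mx_product_density : Sigma_mx X = 3^-1%:M.
Proof.
apply/matrixP => k l; rewrite !mxE.
have iF j : integrable (F j \o X j).
  apply: (@integrable_of_bounded 2^-1); last by move=> w; exact: F_le.
  by apply: measurableT_comp => //; exact: F_measurable.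
rewrite (_ : cdf_transform X k = fun w => 2^-1 + F k (X k w)); last first.
  by apply/funext => w; rewrite cdf_transformE.
rewrite (_ : cdf_transform X l = fun w => 2^-1 + F l (X l w)); last first.
  by apply/funext => w; rewrite cdf_transformE.
rewrite (@covariance_odd 2^-1 (fun j => F j))//; last first.
  apply: (@integrable_of_bounded (2^-1 ^+ 2)).
    by apply: measurable_funX; apply: measurableT_comp => //; exact: F_measurable.
  by move=> w; rewrite /= normrX lerXn2r ?nnegrE//; exact: F_le.
rewrite (integral_centered_cdf_sqr (g_derivable (k := k)) (@g_gt0 k) (g_int1 k)
  (@F_is_derive k) (@F_odd k) (@F_le k)).
by rewrite mulrnAr; congr (_ *+ _); field.
Qed.

Lemma covariance_mx_product_density : finite_second_moments P X ->
  covariance_mx P X = diag_mx (\row_k sigma2 (g k)).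
Proof.
move=> iX2; apply/matrixP => k l; rewrite !mxE.
have := @covariance_odd 0 (fun=> idfun) k l.
rewrite (_ : (fun w => 0 + _) = X k); last by apply/funext => w; rewrite add0r.
rewrite (_ : (fun w => 0 + _) = X l); last by apply/funext => w; rewrite add0r.
apply => //; last exact: iX2.
  by move=> j; exact: measurable_id.
by move=> j; apply: (@integrable_of_sqr (X j)); [exact: measurable_funP|exact: iX2].
Qed.

(** On the line through a point in the direction of the l-th axis, [ln \o f]
    differs from [ln \o g l] by a constant. *)
Lemma score_product_density w l :
  score X f w l 0 = (g l)^`()%classic (X l w) / g l (X l w).
Proof.
rewrite mxE.
set x := random_col X w.
have xE j : x j 0 = X j w by rewrite mxE.
pose c := \prod_(j < K | j != l) g j (x j 0).
have c0 : 0 < c by apply: prodr_gt0 => j _; exact: g_gt0.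
have lnf (h : R) : ln (f (h *: delta_mx l 0 + x)) = ln (g l (h + X l w)) + ln c.
  by rewrite (prod_line f_prod) -/c lnM ?posrE// xE.
have lnf0 : ln (f x) = ln (g l (X l w)) + ln c.
  by have := lnf 0; rewrite scale0r !add0r.
have E : (fun h : R => h^-1 *: (((fun x => ln (f x)) \o shift x)
      (h *: delta_mx l 0) - ln (f x))) =
    (fun h : R => h^-1 *: (((@ln R \o g l) \o shift (X l w)) (h *: 1)
      - (@ln R \o g l) (X l w))).
  apply/funext => h /=; rewrite lnf lnf0 /GRing.scale/= mulr1; ring.
rewrite /derive E -/(derive (@ln R \o g l) (X l w) 1).
have gD : is_derive (X l w) 1 (g l) ((g l)^`()%classic (X l w)).
  by rewrite derive1E; apply/derivableP; exact: g_derivable.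
have := is_derive1_comp (is_derive1_ln (g_gt0 l (X l w))) gD.
by move=> [_ ->]; rewrite mulrC.
Qed.

(** On the diagonal, the density cancels the denominator of the score, which
    leaves the integral computed in [integral_centered_cdf_derive]. *)
Lemma A_mx_product_density : finite_fisher_information P X f ->
  A_mx X f = diag_mx (\row_k - \int[mu]_x (g k x ^+ 2)).
Proof.
move=> fisher; apply/matrixP => k l; rewrite !mxE.
pose s j (y : R) := (g j)^`()%classic y / g j y.
have ms j : measurable_fun [set: R] (s j).
  apply: continuous_measurable_fun => x.
  apply: cvgM; first exact: g'_continuous.
  apply: cvgV; first by rewrite gt_eqF// g_gt0.
  exact: (marginal_density_continuous f_pos f_C1 f_prod).
have isX j : integrable (s j \o X j).
  apply: (@integrable_of_sqr (s j \o X j)); first exact: measurableT_comp.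
  apply: eq_integrable (fisher j j) => // w _ /=.
  by rewrite score_product_density expr2.
have iF j : integrable (F j \o X j).
  apply: (@integrable_of_bounded 2^-1); last by move=> w; exact: F_le.
  by apply: measurableT_comp => //; exact: F_measurable.
rewrite (_ : (fun w => _) = (fun w => F k (X k w) * s l (X l w))); last first.
  apply/funext => w; rewrite cdf_transformE score_product_density.
  by congr (_ * _); lra.
have [<-|kl] := eqVneq k l; last first.
  by rewrite (expectation_marginal_pair_odd kl)//; exact: F_odd.
have mFs : measurable_fun [set: R] (fun x => F k x * s k x).
  by apply: measurable_funM => //; exact: F_measurable.
have iFs : integrable ((fun x => F k x * s k x) \o X k).
  apply: le_integrable (isX k) => //.
    by apply/measurable_EFinP; exact: measurableT_comp.
  move=> w _ /=; rewrite lee_fin normrM ler_piMl// (le_trans (F_le _ _))//; lra.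
have [_] := lawX mFs iFs.
rewrite mulr1n /comp => ->.
have sgE x : s k x * g k x = (g k)^`()%classic x.
  by rewrite /s divfK// gt_eqF// g_gt0.
have ig' : mu.-integrable setT (EFin \o (g k)^`()%classic).
  have [+ _] := lawX (ms k) (isX k).
  by apply: eq_integrable => // x _ /=; rewrite sgE.
have [M gM] := marginal_density_ub f_pos f_marg_bounded k.
rewrite -(integral_centered_cdf_derive (g_derivable (k := k)) (@g'_continuous k)
  (@g_gt0 k) (@g_even k) gM (g_int1 k) (@F_is_derive k) (@F_odd k) (@F_le k) ig').
congr fine; apply: eq_integral => x _.
by rewrite -mulrA sgE.
Qed.

End moments_of_product_density.

(** * The quadratic forms *)

Section diagonal_quadratic_forms.
Context (F : fieldType) (n : nat).

Lemma invmx_diag (D : 'rV[F]_n) : (forall k, D 0 k != 0) ->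
  invmx (diag_mx D) = diag_mx (\row_k (D 0 k)^-1).
Proof.
move=> D0; have DV : diag_mx D *m diag_mx (\row_k (D 0 k)^-1) = 1%:M.
  apply/matrixP => i j; rewrite mul_diag_mx !mxE.
  by case: eqVneq => [->|_]; rewrite ?mulr0// divff.
have [uD _] := mulmx1_unit DV.
by rewrite -[LHS]mulmx1 -DV mulKmx.
Qed.

Lemma quadratic_form_diag (D : 'rV[F]_n) (x : 'cV[F]_n) :
  (x^T *m diag_mx D *m x) 0 0 = \sum_k x k 0 ^+ 2 * D 0 k.
Proof.
by rewrite !mxE; apply: eq_bigr => k _; rewrite mul_mx_diag !mxE mulrAC expr2.
Qed.

End diagonal_quadratic_forms.

Theorem corollary1 (R : realType) (K : nat) (hK : (1 <= K)%N)
    (t1 : R) (ht1 : 0 < t1 < 1) (delta : 'cV[R]_K)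
    (f : 'cV[R]_K -> R) (f_pdf : is_pdf f)
    (f_sym : forall x : 'cV[R]_K, f (- x) = f x)
    (f_pos : forall x, 0 < f x)
    (f_C1 : continuously_differentiable f)
    (f_marg_bounded : forall k, exists M : R, forall y, (marginal f k y <= M%:E)%E)
    (f_prod : forall x, f x = \prod_(k < K) marginal_density f k (x k 0))
    (d : measure_display) (T : measurableType d) (P : probability T R)
    (X : 'I_K -> {RV P >-> R}) (X_density : has_density P X f)
    (X_moment : finite_second_moments P X)
    (X_fisher : finite_fisher_information P X f) :
  let C := covariance_mx P X in
  let dH := d_H t1 C delta in
  let dS := d_S t1 (Sigma_mx X) (A_mx X f) delta in
  let fk := marginal_density f in
  [/\ dH = t1 * (1 - t1) * \sum_(k < K) delta k 0 ^+ 2 / sigma2 (fk k),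
      dS = 12 * t1 * (1 - t1) *
             \sum_(k < K) delta k 0 ^+ 2 / sigma2 (fk k) * lambda (fk k) ^+ 2,
      108 / 125 * dH <= dS &
      (forall k, gaussian_density (fk k)) -> dS = 3 / pi * dH].
Proof.
move=> C dH dS fk.
have p_derivable k := marginal_density_derivable f_pos f_C1 f_prod (k := k).
have p'_continuous k :=
  marginal_density_derive_continuous f_pos f_C1 f_prod (k := k).
have p_gt0 k := marginal_density_gt0 f_pos f_prod k.
have p_even k := marginal_density_even f_sym f_pos f_prod k.
have p_ub k := marginal_density_ub f_pos f_marg_bounded k.
have p_int1 k :=
  integral_marginal_density f_pdf f_pos f_C1 f_marg_bounded f_prod k.
have p_moment k : (@lebesgue_measure R).-integrable setT
    (EFin \o (fun x => x ^+ 2 * fk k x)).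
  have [] := expectation_marginal f_pdf f_pos f_C1 f_marg_bounded f_prod
    X_density (k := k) (h := fun x => x ^+ 2) => //.
  exact: X_moment.
have s0 k : 0 < sigma2 (fk k).
  exact: (sigma2_gt0 (p_gt0 k) (p_moment k)).
have dHE : dH = t1 * (1 - t1) * \sum_(k < K) delta k 0 ^+ 2 / sigma2 (fk k).
  rewrite /dH /d_H /C (covariance_mx_product_density f_pdf f_sym f_pos f_C1
    f_marg_bounded f_prod X_density X_moment).
  rewrite invmx_diag; last by move=> k; rewrite mxE gt_eqF.
  by rewrite quadratic_form_diag; congr (_ * _); apply: eq_bigr => k _; rewrite !mxE.
have dSE : dS = 12 * t1 * (1 - t1) *
    \sum_(k < K) delta k 0 ^+ 2 / sigma2 (fk k) * lambda (fk k) ^+ 2.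
  rewrite /dS /d_S.
  rewrite (Sigma_mx_product_density f_pdf f_sym f_pos f_C1 f_marg_bounded f_prod X_density).
  rewrite (A_mx_product_density f_pdf f_sym f_pos f_C1 f_marg_bounded f_prod X_density X_fisher).
  rewrite invmx_scalar invrK tr_diag_mx.
  rewrite -(mulmxA _ _ (diag_mx _)) mul_scalar_mx -scalemxAr -!scalemxAl mxE.
  rewrite -(mulmxA _ (diag_mx _) (diag_mx _)) mulmx_diag quadratic_form_diag.
  rewrite [X in X = _](_ : _ = 12 * t1 * (1 - t1) *
    \sum_(k < K) delta k 0 ^+ 2 * (\int[lebesgue_measure]_x (fk k x ^+ 2)) ^+ 2).
    congr (_ * _); apply: eq_bigr => k _.
    rewrite (lambda_sqrE (p_derivable k) (p_gt0 k) (p_moment k)) mulrA divfK//.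
    by rewrite gt_eqF.
  rewrite (eq_bigr (fun k => delta k 0 ^+ 2 *
    (\int[lebesgue_measure]_x (fk k x ^+ 2)) ^+ 2)); last first.
    by move=> k _; rewrite !mxE mulrNN.
  by ring.
have t0 : 0 <= t1 * (1 - t1).
  by have /andP[? ?] := ht1; rewrite mulr_ge0// ?subr_ge0 ltW.
have dt k : 0 <= delta k 0 ^+ 2 / sigma2 (fk k).
  by rewrite divr_ge0 ?sqr_ge0// ltW.
split => //.
- rewrite dHE dSE.
  have : (\sum_(k < K) delta k 0 ^+ 2 / sigma2 (fk k)) * (9 / 125) <=
         \sum_(k < K) delta k 0 ^+ 2 / sigma2 (fk k) * lambda (fk k) ^+ 2.
    rewrite mulr_suml; apply: ler_sum => k _; apply: ler_wpM2l => //.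
    have [M pM] := p_ub k.
    exact: (lambda_sqr_ge (p_derivable k) (p_gt0 k) pM (p_int1 k) (p_moment k)).
  move=> /(ler_wpM2l t0); lra.
- move=> gauss; rewrite dHE dSE.
  have lE k : lambda (fk k) ^+ 2 = (4 * pi)^-1.
    exact: (gaussian_lambda_sqr (p_derivable k) (p_gt0 k) (p_even k) (p_int1 k) (p_moment k)).
  under eq_bigr do rewrite lE.
  rewrite -mulr_suml.
  have := pi_gt0 R; move: (@pi R) => c c0.
  by field; rewrite gt_eqF.
Qed.
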